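(* Let $n\in\{3,4,6\}$ and let $P$ be a regular $n$-gon. For every $0<\lambda<1$, the outer billiards map with contraction $T_\lambda$ outside $P$ has only finitely many periodic orbits, and the orbit of every point $x\in X_\lambda$ is attracted to one of them. Moreover, in the limit $\lambda\nearrow 1$ all periodic orbits of the usual outer billiards map $T=T_1$ outside $P$ are recovered, i.e. for every periodic point $x\in X_1$ of $T$ there is $\epsilon>0$ such that for all $1-\epsilon<\lambda<1$ the map $T_\lambda$ has a periodic point with the same code as $x$.
   Context: Outer billiards with contraction: let $P\subset\mathbb{R}^2$ be a (closed) convex polygon and $0<\lambda\le 1$. For a generic point $x\in\mathbb{R}^2\setminus P$ there is a unique vertex $v$ of $P$ such that $P$ lies on the left side of the ray starting from $x$ and passing through $v$; set $T_\lambda x=y$, where $y$ is the point of this ray on the opposite side of $v$ from $x$ with $|xv|:|vy|=1:\lambda$, i.e. $T_\lambda x=v-\lambda(x-v)$. One says that $x$ gets reflected on $v$. The exceptional points, where $v$ is not unique, form the set $S$, a union of rays extending the sides of $P$. $T_\lambda$ is considered as a map on the domain $X_\lambda=\mathbb{R}^2\setminus\big(P\cup\bigcup_{i\ge0}T_\lambda^{-i}S\big)$. For $\lambda=1$ this is the usual outer billiards map $T=T_1$. Code: label the vertices of $P$ by $1,\dots,n$; the code of $x\in X_\lambda$ (with respect to $T_\lambda$) is the sequence $\{a_k(x)\}_{k\ge0}$, where $a_k(x)$ is the label of the vertex on which $T_\lambda^k(x)$ gets reflected. The orbit of $x$ is attracted to a periodic orbit $O$ if the distance from $T_\lambda^k(x)$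 to $O$ tends to $0$ as $k\to\infty$. *)

(* Defs.v *)
From HB Require Import structures.
From mathcomp Require Import all_boot all_order all_algebra.
From mathcomp Require Import all_classical all_reals all_analysis.

Set Implicit Arguments.
Unset Strict Implicit.
Unset Printing Implicit Defensive.

Import Order.TTheory GRing.Theory Num.Theory.
Import numFieldNormedType.Exports.

Local Open Scope classical_set_scope.
Local Open Scope ring_scope.

Notation plane R := (R * R)%type.

Section OuterBilliards.
Variable R : realType.

(* The distance is defined by hand because the library norm on [R * R] is the
   sup norm. *)
Definition eucl_dist (x y : plane R) : R :=
  Num.sqrt ((x.1 - y.1) ^+ 2 + (x.2 - y.2) ^+ 2).

Definition dist_to_set (x : plane R) (A : set (plane R)) : R :=
  inf [set eucl_dist x y | y in A].

(* [cross a b >= 0] iff [b] lies in the closed half-plane to the left of the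
   line directed by [a]. *)
Definition cross (a b : plane R) : R := a.1 * b.2 - a.2 * b.1.

Variable n : nat.

(* Arbitrary centre, circumradius and position; the labels increase
   counterclockwise. *)
Definition regular_polygon (v : 'I_n -> plane R) : Prop :=
  exists (c : plane R) (r theta : R), 0 < r /\
    forall k : 'I_n,
      v k = (c.1 + r * cos (theta + 2 * pi * k%:R / n%:R),
             c.2 + r * sin (theta + 2 * pi * k%:R / n%:R)).

Variable v : 'I_n -> plane R.

Definition polygon : set (plane R) :=
  [set x | exists w : 'I_n -> R,
    [/\ forall i, 0 <= w i, \sum_(i < n) w i = 1
      & x = \sum_(i < n) w i *: v i]].

(* The polygon is on the left of the ray from [x] through [v i]. *)
Definition left_of_ray (x : plane R) (i : 'I_n) : Prop :=
  forall p, polygon p -> 0 <= cross (v i - x) (p - x).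

Definition singular_set : set (plane R) :=
  [set x | ~ polygon x /\ ~ (exists! i, left_of_ray x i)].

(* Total function: outside the polygon and [singular_set] it returns the unique
   vertex on which [x] gets reflected; elsewhere its value is irrelevant. *)
Definition refl_vertex (x : plane R) : option 'I_n :=
  [pick i | `[< left_of_ray x i >]].

Variable lam : R.

(* The value [x] in the second branch is a dummy, never reached from a point of
   [billiard_domain]. *)
Definition billiard (x : plane R) : plane R :=
  if refl_vertex x is Some i then v i - lam *: (x - v i) else x.

(* The dummy values of [billiard] do not affect this set: if the orbit of [x]
   meets [singular_set], then [x] is already removed at the first such time. *)
Definition billiard_domain : set (plane R) :=
  ~` (polygon `|` \bigcup_i (iter i billiard @^-1` singular_set)).

(* On [billiard_domain] every entry of the code is of the form [Some i]. *)
Definition billiard_code (x : plane R) (k : nat) : option 'I_n :=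
  refl_vertex (iter k billiard x).

Definition periodic_point (x : plane R) : Prop :=
  billiard_domain x /\ exists2 k : nat, (0 < k)%N & iter k billiard x = x.

Definition billiard_orbit (x : plane R) : set (plane R) :=
  range (fun k : nat => iter k billiard x).

Definition periodic_orbit (O : set (plane R)) : Prop :=
  exists2 x, periodic_point x & O = billiard_orbit x.

Definition attracted_to (x : plane R) (O : set (plane R)) : Prop :=
  (fun k : nat => dist_to_set (iter k billiard x) O) @ \oo --> (0 : R).

End OuterBilliards.

(* Main.v *)
Require Import Defs.
From HB Require Import structures.
From mathcomp Require Import all_boot all_order all_algebra.
From mathcomp Require Import all_classical all_reals all_analysis.
From mathcomp Require Import ring lra zify.
Import Order.TTheory GRing.Theory Num.Theory.
Import numFieldNormedType.Exports.
Local Open Scope classical_set_scope.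
Local Open Scope ring_scope.
Set Implicit Arguments.
Unset Strict Implicit.
Unset Printing Implicit Defensive.

(** Write a point reflected on vertex [v_i] as [v_i - a e_(i-1) - b e_i] with
    [a, b > 0], where [e_i = v_(i+1) - v_i]. In these coordinates the billiard
    map is [z |-> S^j (- lam z)], where the affine map [S] changes the frame from
    one vertex to the next and [j] is the increment of the code. Hence, once the
    increments [J] are fixed, the orbit depends affinely on the starting point,
    and the points with increments [J] form a convex set.

    Suppose that [J] is [m]-periodic and that the rotation part [Q] of the
    [m]-th iterate satisfies [1 + Q + kappa Q^2 = 0] with [kappa >= 0]. With
    [L = lam^m] and [z_i] the [(i m)]-th iterate of a point [z_0] with increments
    [J], the convex combination of [z_0, z_1, z_2] with weights proportional to
    [L^2, L, kappa] is fixed by the [m]-th iterate. By convexity it is a genuine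
    periodic point with increments [J], so the orbit of [z_0] is attracted to
    it; as it depends continuously on [lam], the case [lam = 1] persists for
    [lam] close to [1].

    It remains to see that increments are eventually of this kind. Far from the
    polygon an orbit repeats a word [A] ([2 1], [2], [3] for [n = 3, 4, 6]) whose
    linear part is a homothety, and each run [A^N] is ended by a letter [B]. The
    run lengths satisfy [N_(r+2) <= N_r], so the increments end up as
    [(A^N B A^M B)^oo], whose rotation part is that of [B B], of order 3, 2, 3.
    The hexagon also has the tail [1 1 1 ...]. The run lengths are bounded in
    terms of [lam < 1], which leaves finitely many eventual codes. *)

(** * Itineraries in vertex coordinates *)

Section Frames.
(* [t = 2 cos (2 pi / n)], so that [e_(i-1) + e_(i+1) = t e_i]. *)
Variables (R : realType) (t : R).

(** The map [S]: substitute [v_i = v_(i+1) - e_i] and [e_(i-1) = t e_i - e_(i+1)] in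
    [v_i - a e_(i-1) - b e_i]. *)
Definition shift_frame (z : R * R) : R * R := (1 + t * z.1 + z.2, - z.1).

Definition frame_step (lam : R) (j : nat) (z : R * R) : R * R :=
  iter j shift_frame (- (lam * z.1), - (lam * z.2)).

Fixpoint traj (lam : R) (J : nat -> nat) (z : R * R) (k : nat) : R * R :=
  if k is k'.+1 then frame_step lam (J k') (traj lam J z k') else z.

Definition quadrant (z : R * R) : Prop := 0 < z.1 /\ 0 < z.2.

(** Positivity says that each point is reflected on the vertex of its current frame, so that [J]
    really lists the increments of the code. *)
Definition admissible (lam : R) (J : nat -> nat) (z : R * R) : Prop :=
  forall k, quadrant (traj lam J z k).

Definition lin_shift (z : R * R) : R * R := (t * z.1 + z.2, - z.1).

(* Linear part of [frame_step 1 j]; the factor [lam] is kept apart. *)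
Definition lin_step (j : nat) (z : R * R) : R * R :=
  iter j lin_shift (- z.1, - z.2).

Fixpoint lin_traj (J : nat -> nat) (z : R * R) (k : nat) : R * R :=
  if k is k'.+1 then lin_step (J k') (lin_traj J z k') else z.

Definition comb3 (p q s : R) (x y z : R * R) : R * R :=
  (p * x.1 + q * y.1 + s * z.1, p * x.2 + q * y.2 + s * z.2).

Definition psub (z y : R * R) : R * R := (z.1 - y.1, z.2 - y.2).

Definition pscale (l : R) (z : R * R) : R * R := (l * z.1, l * z.2).

Lemma eq_traj lam J J' z k : J =1 J' -> traj lam J z k = traj lam J' z k.
Proof. by move=> e; elim: k => //= k ->; rewrite e. Qed.

Lemma eq_lin_traj J J' z k :
  (forall i, (i < k)%N -> J i = J' i) -> lin_traj J z k = lin_traj J' z k.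
Proof.
elim: k => //= k IH e; rewrite e // IH // => i ik; apply: e; exact: leqW.
Qed.

Lemma trajD lam J z k l :
  traj lam J z (k + l) = traj lam (fun i => J (k + i)%N) (traj lam J z k) l.
Proof. by elim: l => [|l IH]; rewrite ?addn0 // addnS /= IH. Qed.

Lemma lin_trajD J z k l :
  lin_traj J z (k + l) = lin_traj (fun i => J (k + i)%N) (lin_traj J z k) l.
Proof. by elim: l => [|l IH]; rewrite ?addn0 // addnS /= IH. Qed.

Lemma admissible_shift lam J z k :
  admissible lam J z -> admissible lam (fun i => J (k + i)%N) (traj lam J z k).
Proof. by move=> adm l; rewrite -trajD. Qed.

Lemma traj_comb3 lam J p q s x y z k : p + q + s = 1 ->
  traj lam J (comb3 p q s x y z) k =
  comb3 p q s (traj lam J x k) (traj lam J y k) (traj lam J z k).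
Proof.
move=> pqs; elim: k => //= k ->; rewrite /frame_step.
elim: (J k) => [|j /= ->]; rewrite /shift_frame /comb3 /=.
  by congr pair; ring.
by congr pair; [rewrite -{1}pqs; ring|ring].
Qed.

Lemma lin_step_scale j l z : lin_step j (pscale l z) = pscale l (lin_step j z).
Proof.
rewrite /lin_step; elim: j => [|j /= ->]; rewrite /lin_shift /pscale /=;
  by congr pair; ring.
Qed.

(** Translations cancel in a difference, and each step contributes one factor [lam]. *)
Lemma traj_sub lam J z y k :
  psub (traj lam J z k) (traj lam J y k) =
  pscale (lam ^+ k) (lin_traj J (psub z y) k).
Proof.
elim: k => [|k IH] /=; first by rewrite /pscale /psub expr0 !mul1r.
rewrite exprSr mulrC.
have -> : forall w, pscale (lam * lam ^+ k) w = pscale lam (pscale (lam ^+ k) w).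
  by move=> w; rewrite /pscale /= !mulrA.
rewrite -lin_step_scale -IH -lin_step_scale /frame_step /lin_step.
elim: (J k) => [|j /= <-]; rewrite /lin_shift /shift_frame /psub /pscale /=;
  by congr pair; ring.
Qed.

Definition contracting (J : nat -> nat) (m : nat) (kappa : R) : Prop :=
  0 <= kappa /\ forall z, let T := fun w => lin_traj J w m in
    z.1 + (T z).1 + kappa * (T (T z)).1 = 0 /\
    z.2 + (T z).2 + kappa * (T (T z)).2 = 0.

Definition cycle_point (lam : R) (J : nat -> nat) m (kappa : R) (z : R * R) :=
  let L := lam ^+ m in let W := L ^+ 2 + L + kappa in
  comb3 (L ^+ 2 / W) (L / W) (kappa / W)
    z (traj lam J z m) (traj lam J z (m + m)).

Section Cycle.
Variables (lam : R) (J : nat -> nat) (m : nat) (kappa : R) (z : R * R).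
Hypotheses (lam_gt0 : 0 < lam) (perJ : forall i, J (i + m)%N = J i).
Hypothesis cJ : contracting J m kappa.

Let L_gt0 : 0 < lam ^+ m. Proof. exact: exprn_gt0. Qed.

Let W_gt0 : 0 < (lam ^+ m) ^+ 2 + lam ^+ m + kappa.
Proof. by case: cJ => k0 _; rewrite ltr_wpDr// addr_gt0// exprn_gt0. Qed.

Lemma traj_period y k : traj lam J y (m + k) = traj lam J (traj lam J y m) k.
Proof. by rewrite trajD; apply: eq_traj => i; rewrite addnC perJ. Qed.

Let weights : (lam ^+ m) ^+ 2 / ((lam ^+ m) ^+ 2 + lam ^+ m + kappa) +
  lam ^+ m / ((lam ^+ m) ^+ 2 + lam ^+ m + kappa) +
  kappa / ((lam ^+ m) ^+ 2 + lam ^+ m + kappa) = 1.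
Proof. by rewrite -!mulrDl divff // gt_eqF. Qed.

(** With [d_i = z_(i+1) - z_i] one has [d_1 = L Q d_0] and [d_2 = L^2 Q^2 d_0]. Applying one period
    moves the point by [(L^2 d_0 + L d_1 + kappa d_2) / W], which is [L^2 / W] times
    [(1 + Q + kappa Q^2) d_0 = 0]. *)
Lemma cycle_point_fixed :
  traj lam J (cycle_point lam J m kappa z) m = cycle_point lam J m kappa z.
Proof.
rewrite traj_comb3 // -!traj_period /cycle_point.
move: W_gt0; set W := _ + kappa => W0; set L := lam ^+ m.
have Wn0 : W != 0 by rewrite gt_eqF.
have := traj_sub lam J (traj lam J z m) z m.
have := traj_sub lam J (traj lam J z (m + m)) (traj lam J z m) m.
have := traj_sub lam J (traj lam J z m) z (m + m).
rewrite lin_trajD (eq_lin_traj (J' := J)); last first.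
  by move=> i _; rewrite addnC perJ.
rewrite -!traj_period.
case: cJ => _ /(_ (psub (traj lam J z m) z)) /=.
set T1 := lin_traj J _ m; set T2 := lin_traj J T1 m.
set y0 := z; set y1 := traj lam J z m; set y2 := traj lam J z (m + m).
set y3 := traj lam J z (m + (m + m)).
rewrite /psub /pscale => -[/= e1 e2] [E1 E2] _ [F1 F2].
have e : lam ^+ (m + m) = L ^+ 2 by rewrite exprD expr2.
rewrite e in E1 E2.
have G1 : L ^+ 2 * (y1.1 - y0.1) + L * (y2.1 - y1.1) + kappa * (y3.1 - y2.1) = 0.
  rewrite E1 F1 -/L.
  transitivity (L ^+ 2 * (y1.1 - y0.1 + T1.1 + kappa * T2.1)); first ring.
  by rewrite e1 mulr0.
have G2 : L ^+ 2 * (y1.2 - y0.2) + L * (y2.2 - y1.2) + kappa * (y3.2 - y2.2) = 0.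
  rewrite E2 F2 -/L.
  transitivity (L ^+ 2 * (y1.2 - y0.2 + T1.2 + kappa * T2.2)); first ring.
  by rewrite e2 mulr0.
have -> : traj lam J y2 m = y3 by rewrite /y2 traj_period -!traj_period.
rewrite /comb3 /=; congr pair; apply/eqP; rewrite -subr_eq0; apply/eqP.
  by rewrite -[RHS](mul0r W^-1) -G1; ring.
by rewrite -[RHS](mul0r W^-1) -G2; ring.
Qed.

Lemma cycle_point_admissible :
  admissible lam J z -> admissible lam J (cycle_point lam J m kappa z).
Proof.
case: cJ => k0 _ adm k; rewrite traj_comb3 // /comb3 /quadrant /=.
have [a0 b0] := adm k.
have [a1 b1] : quadrant (traj lam J (traj lam J z m) k).
  by rewrite -traj_period; exact: adm.
have [a2 b2] : quadrant (traj lam J (traj lam J z (m + m)) k).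
  rewrite traj_period -!traj_period; exact: adm.
by split; apply: ltr_wpDr; rewrite ?addr_gt0 ?mulr_gt0 ?mulr_ge0 ?invr_ge0
  ?invr_gt0 ?exprn_gt0 // ltW.
Qed.

Lemma traj_cycle_point k q :
  traj lam J (cycle_point lam J m kappa z) (k + q * m) =
  traj lam J (cycle_point lam J m kappa z) k.
Proof.
elim: q => [|q IH]; first by rewrite addn0.
by rewrite mulSn addnCA traj_period cycle_point_fixed.
Qed.

End Cycle.
End Frames.

(** * Runs and returns *)

Lemma nat_nonincreasing_stationary (u : nat -> nat) :
  (forall r, (u r.+1 <= u r)%N) ->
  exists r0, forall r, (r0 <= r)%N -> u r = u r0.
Proof.
move=> dec; have ex : exists m, `[< exists r, u r = m >].
  by exists (u 0%N); apply/asboolP; exists 0%N.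
case: (ex_minnP ex) => m /asboolP[r0 r0m] min; exists r0 => r r0r.
apply/eqP; rewrite eqn_leq; apply/andP; split; last first.
  by rewrite r0m; apply: min; apply/asboolP; exists r.
rewrite -(subnKC r0r); elim: (r - r0)%N => [|j IH]; first by rewrite addn0.
by rewrite addnS; apply: leq_trans IH.
Qed.

Section AffineIterates.
Variables (R : realType) (mu c : R).

Let f x := mu * x - c.
Let g x := mu * x + c.

Lemma iter_f_mono n y z : 0 < mu -> y <= z -> iter n f y <= iter n f z.
Proof.
move=> mu0; elim: n y z => //= n IH y z yz.
by rewrite /f lerD2r ler_pM2l // IH.
Qed.

Lemma iter_g_ge0 n x : 0 < mu -> 0 <= c -> 0 <= x -> 0 <= iter n g x.
Proof.
by move=> mu0 c0 x0; elim: n => //= n IH; rewrite /g addr_ge0 // mulr_ge0 // ltW.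
Qed.

(** Peel off the innermost pair: by monotonicity of [f] it suffices that
    [f (kap * g y - e) <= kap * y - e] for [y >= 0]. This compares consecutive runs: what [a] gains
    over [n] words is undone by [n] words of descent of [h]. *)
Lemma iter_f_iter_g kap e x n : 0 < mu <= 1 -> 0 <= kap <= 1 -> 0 <= e <= c ->
  0 <= x -> iter n f (kap * iter n g x - e) <= kap * x - e.
Proof.
move=> /andP[mu0 mu1] /andP[k0 k1] /andP[e0 ec] x0.
have c0 : 0 <= c by lra.
elim: n => // n IH; rewrite iterSr; apply: le_trans IH; apply: iter_f_mono => //.
have y0 := iter_g_ge0 n mu0 c0 x0.
rewrite /= /f {1}/g; move: (iter n g x) y0 => y y0.
have mk : mu * kap <= mu by rewrite ler_piMr// ltW.
have h1 : mu * mu * (kap * y) <= kap * y.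
  by rewrite ler_piMl ?mulr_ge0// mulr_ile1// ltW.
have h2 : 0 <= (1 - mu) * (c - e) by rewrite mulr_ge0//; lra.
have h3 : 0 <= c * (mu - mu * kap) by rewrite mulr_ge0//; lra.
nra.
Qed.

End AffineIterates.

Section Returns.
Variables (R : realType) (lam mu c d s : R).
(* [a k] and [h k] are adapted coordinates of the [k]-th point of an orbit: the
   height [h] decreases along a run of words [A], which ends once [lam * h < d]. *)
Variables (a h : nat -> R) (J : nat -> nat) (A : seq nat) (B : nat).

Let f x := mu * x - c.
Let g x := mu * x + c.

Definition block_len (N : nat) := (N * size A).+1.

Definition block_letter (N j : nat) : nat :=
  if (j < N * size A)%N then nth 0%N A (j %% size A) else B.

(** The orbit reads [A^N B] from time [k] on, and the last two clauses give the coordinates at the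
    start of the next block. The constant [s] is 0 when the next height does not depend on the
    current one (square), and 1 otherwise. *)
Definition block (k N : nat) : Prop :=
  [/\ forall j, (j < N)%N -> d < lam * iter j f (h k),
      lam * iter N f (h k) < d,
      forall j, (j < block_len N)%N -> J (k + j)%N = block_letter N j,
      a (k + block_len N)%N = d - lam * iter N f (h k)
    & h (k + block_len N)%N =
      lam * iter N g (a k) + s * (lam * iter N f (h k) - 1)].

Hypotheses (lam_gt0 : 0 < lam) (mu_gt0 : 0 < mu) (mu_le1 : mu <= 1).
Hypotheses (c_ge1 : 1 <= c) (d_ge1 : 1 <= d).

Hypothesis step : forall k : nat,
  [/\ d < lam * h k, forall j, (j < size A)%N -> J (k + j)%N = nth 0%N A j,
      a (k + size A)%N = g (a k) & h (k + size A)%N = f (h k)] \/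
  [/\ lam * h k < d, J k = B, a k.+1 = d - lam * h k
    & h k.+1 = lam * a k + s * (lam * h k - 1)].

Ltac section_hyps := pose proof lam_gt0; pose proof mu_gt0;
  pose proof mu_le1; pose proof c_ge1; pose proof d_ge1.
Tactic Notation "slra" := section_hyps; lra.
Tactic Notation "snra" := section_hyps; nra.

(** Induction on an integer bound of the height: each word [A] lowers a positive height by at least
    1, so the run has to stop. *)
Lemma block_exists k : exists N, block k N.
Proof.
have [b] : exists b : nat, h k < b%:R.
  by exists (Num.bound `|h k|); rewrite (le_lt_trans (ler_norm _))// archi_boundP.
elim: b k => [|b IH] k hb; case: (step k) => [[dh JA ak hk]|[hd JB ak hk]].
- exfalso; suff lh : lam * h k < 0 by slra.
  by rewrite pmulr_rlt0.
- exists 0%N; split => //=; rewrite /block_len mul0n ?addn1//.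
  by move=> j; rewrite ltnS leqn0 => /eqP->; rewrite addn0.
- have hpos : 0 < h k by rewrite -(pmulr_rgt0 _ lam_gt0); slra.
  have hb' : h (k + size A)%N < b%:R.
    have : mu * h k <= h k by rewrite ler_piMl// ltW.
    by rewrite hk /f; move: hb; rewrite -natr1; slra.
  case: (IH _ hb') => N [N1 N2 N3 N4 N5].
  have len : block_len N.+1 = (size A + block_len N)%N.
    by rewrite /block_len mulSn addnS.
  exists N.+1; rewrite /block len addnA !iterSr -hk -ak; split => //.
    by case=> //= j jN; rewrite -iterS iterSr -hk; apply: N1.
  move=> j jlt; rewrite /block_letter; have [jA|Aj] := ltnP j (size A).
    by rewrite mulSn ltn_addr// modn_small// JA.
  rewrite -(subnKC Aj) addnA N3; last by rewrite ltn_subLR.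
  by rewrite /block_letter mulSn ltn_add2l modnDl.
- exists 0%N; split => //=; rewrite /block_len mul0n ?addn1//.
  by move=> j; rewrite ltnS leqn0 => /eqP->; rewrite addn0.
Qed.

Lemma iter_f_le k N : (forall j, (j < N)%N -> d < lam * iter j f (h k)) ->
  iter N f (h k) <= h k - N%:R.
Proof.
elim: N => [|N IH] big /=; first by rewrite subr0.
have := IH (fun j jN => big j (leqW jN)).
have : 0 < iter N f (h k) by rewrite -(pmulr_rgt0 _ lam_gt0) (lt_trans _ (big N _))//; slra.
move=> pos le; have : mu * iter N f (h k) <= iter N f (h k) by rewrite ler_piMl// ltW.
by rewrite /f -natr1; slra.
Qed.

(** The height is still positive before the last word of the run, and every earlier word has lowered
    it by at least 1. *)
Lemma block_bound k N C : block k N -> h k <= C -> (N <= Num.bound (C + 1))%N.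
Proof.
case=> big _ _ _ _ hC; case: N big => // N big.
have := iter_f_le (fun j jN => big j (leqW jN)).
have pos : 0 < iter N f (h k) by rewrite -(pmulr_rgt0 _ lam_gt0) (lt_trans _ (big N _))//; slra.
move=> le; have NC : N.+1%:R < C + 1 by rewrite -natr1; slra.
have C0 : 0 <= C + 1 by have := ler0n R N.+1; slra.
by have := lt_trans NC (archi_boundP C0); rewrite ltr_nat => /ltnW.
Qed.

(** The bound is the fixed point of the increasing map [g], and [x] starts below it. *)
Lemma iter_g_le x N : mu < 1 -> x < c -> iter N g x <= c / (1 - mu).
Proof.
move=> mu1 xc; have m0 : 0 < 1 - mu by slra.
elim: N => [|N IH] /=.
  rewrite (le_trans (ltW xc))// ler_pdivlMr// ler_piMr//; slra.
have -> : c / (1 - mu) = g (c / (1 - mu)).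
  by rewrite /g; field; rewrite gt_eqF.
by rewrite /g lerD2r ler_pM2l.
Qed.

Lemma block_h_le k N : lam <= 1 -> mu < 1 -> 0 <= s <= 1 -> a k < c ->
  block k N -> h (k + block_len N)%N <= c / (1 - mu) + d.
Proof.
move=> lam1 mu1 /andP[s0 s1] ac [_ small _ _ ->].
have C0 : 0 <= c / (1 - mu) by rewrite divr_ge0//; slra.
have := iter_g_le N mu1 ac => G.
have : lam * iter N g (a k) <= c / (1 - mu).
  have [p|n] := leP 0 (iter N g (a k)); first by rewrite (le_trans _ G)// ler_piMl.
  by rewrite (le_trans _ C0)// pmulr_rle0// ltW.
have : s * (lam * iter N f (h k) - 1) <= d.
  have [p|n] := leP 0 (lam * iter N f (h k) - 1); first by snra.
  by snra.
by slra.
Qed.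

(** [N'] is the first time at which the height drops below [d / lam]. *)
Lemma block_leq k' N N' : block k' N' ->
  lam * iter N f (h k') < d -> (N' <= N)%N.
Proof.
move=> [big _ _ _ _] small; rewrite leqNgt; apply/negP => /big.
by move=> /(lt_trans small); rewrite ltxx.
Qed.

Variable sec : nat -> Prop.
Hypothesis sec_next : forall k N, sec k -> block k N -> sec (k + block_len N)%N.
Hypothesis sec_mono : forall k N M N', sec k -> block k N ->
  block (k + block_len N)%N M ->
  block (k + block_len N + block_len M)%N N' -> (N' <= N)%N.

(** Let [N_r] be the successive run lengths. Since [N_(r+2) <= N_r], the sums [N_r + N_(r+1)] are
    nonincreasing, hence eventually constant, and then [N_(r+2) = N_r]. *)
Lemma block_tail k0 : sec k0 -> exists k N M, [/\ sec k, block k N,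
  block (k + block_len N)%N M
  & forall i, J (k + i + (block_len N + block_len M))%N = J (k + i)%N].
Proof.
move=> sec0; have [n nP] := choice block_exists.
pose sg r := iter r (fun k => k + block_len (n k))%N k0.
have sgS r : sg r.+1 = (sg r + block_len (n (sg r)))%N by [].
have secg r : sec (sg r) by elim: r => // r IH; rewrite sgS; exact: sec_next.
have dec r : (n (sg r.+2) <= n (sg r))%N.
  by apply: (@sec_mono (sg r) _ (n (sg r.+1))); rewrite // -?sgS.
pose u r := (n (sg r) + n (sg r.+1))%N.
have udec r : (u r.+1 <= u r)%N by rewrite /u addnC leq_add2r.
have [r0 r0P] := nat_nonincreasing_stationary udec.
have per r : (r0 <= r)%N -> n (sg r.+2) = n (sg r).
  move=> r0r; have := r0P _ (leqW r0r); rewrite -(r0P _ r0r) /u addnC.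
  by move/eqP; rewrite eqn_add2r => /eqP.
(* Blocks [r] and [r + 2] agree letter by letter; an index beyond them is passed on to blocks
   [r + 1] and [r + 3]. *)
have tail i r : (r0 <= r)%N -> J (sg r.+2 + i)%N = J (sg r + i)%N.
  elim/ltn_ind: i r => i IH r r0r.
  have [_ _ J1 _ _] := nP (sg r); have [_ _ J2 _ _] := nP (sg r.+2).
  rewrite per // in J2; have [lt|le] := ltnP i (block_len (n (sg r))).
    by rewrite J1 // J2.
  rewrite -(subnKC le) !addnA -{1}(per _ r0r) -!sgS IH ?leqW //.
  by rewrite ltn_subrL /= (leq_trans _ le).
exists (sg r0), (n (sg r0)), (n (sg r0.+1)); split.
- exact: secg.
- exact: nP.
- exact: (nP (sg r0.+1)).
by move=> i; rewrite addnAC addnA -!sgS tail.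
Qed.

End Returns.

Section ReturnDynamics.
Variables (R : realType) (t lam mu c d s e kappa : R).
Variables (a h : nat -> R) (J : nat -> nat) (A : seq nat) (B : nat).

Hypotheses (lam_gt0 : 0 < lam) (lam_le1 : lam <= 1).
Hypotheses (mu_gt0 : 0 < mu) (mu_le1 : mu <= 1).
Hypotheses (c_ge1 : 1 <= c) (d_ge1 : 1 <= d).
Hypothesis s01 : 0 <= s <= 1.
(** Heights at the start of a block exceed [- e], which keeps [a] below [c] at the next start. The
    square and the hexagon use [e = 0]; the triangle, whose height is a difference of coordinates,
    uses [e = 1]. *)
Hypotheses (f_gt : forall x, d < lam * x -> - e < mu * x - c).
Hypothesis c_bound : d + lam * e <= c.

Hypothesis step : forall k : nat,
  [/\ d < lam * h k, forall j, (j < size A)%N -> J (k + j)%N = nth 0%N A j,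
      a (k + size A)%N = mu * a k + c & h (k + size A)%N = mu * h k - c] \/
  [/\ lam * h k < d, J k = B, a k.+1 = d - lam * h k
    & h k.+1 = lam * a k + s * (lam * h k - 1)].

Let f x := mu * x - c.
Let g x := mu * x + c.
Let blk := block lam mu c d s a h J A B.
Let len := block_len A.

Hypothesis h_gt : forall k N, blk k N -> - e < h (k + len N)%N.

Hypothesis mono : forall k N M N', a k < c -> a (k + len N)%N < c ->
  blk k N -> blk (k + len N)%N M -> blk (k + len N + len M)%N N' -> (N' <= N)%N.

Hypothesis A_id : forall z, lin_traj t (nth 0%N A) z (size A) = z.
Hypothesis kappa_ge0 : 0 <= kappa.
Hypothesis B_rot : forall z, let T := fun w => lin_step t B (lin_step t B w) in
  z.1 + (T z).1 + kappa * (T (T z)).1 = 0 /\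
  z.2 + (T z).2 + kappa * (T (T z)).2 = 0.

Lemma lin_traj_block N z :
  lin_traj t (block_letter A B N) z (len N) = lin_step t B z.
Proof.
elim: N => [|N IH]; first by [].
have -> : len N.+1 = (size A + len N)%N by rewrite /len /block_len mulSn addnS.
rewrite lin_trajD [lin_traj t _ z _](eq_lin_traj _ (J' := nth 0%N A)); last first.
  by move=> i iA; rewrite /block_letter mulSn ltn_addr // modn_small.
rewrite A_id -[RHS]IH; apply: eq_lin_traj => i _.
by rewrite /block_letter mulSn ltn_add2l modnDl.
Qed.

Lemma a_next_lt k N : - e < h k -> blk k N -> a (k + len N)%N < c.
Proof.
move=> hk [big _ _ -> _]; suff he : - e < iter N f (h k).
  have := c_bound; suff : - (lam * iter N f (h k)) < lam * e.
    by move: c_bound => ?; lra.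
  by rewrite -mulrN ltr_pM2l // ltrNl.
by case: N big => // N /(_ N (ltnSn _)) /f_gt.
Qed.

(** The period consists of two blocks, [A^N B A^M B]. The words [A] have trivial linear part, so
    only the two letters [B] rotate, whatever [N] and [M] are; for [mu < 1] the height bound limits
    both run lengths. *)
Lemma returns_contracting : exists k m, [/\ (0 < m)%N,
  mu < 1 -> (m <= 2 * (Num.bound (c / (1 - mu) + d + 1)%R * size A).+1)%N,
  forall i, J (k + i + m)%N = J (k + i)%N
  & contracting t (fun i => J (k + i)%N) m kappa].
Proof.
have bex k : exists N, blk k N by apply: block_exists.
pose sec k := [/\ a k < c, - e < h k & mu < 1 -> h k <= c / (1 - mu) + d].
have sec_next k N : a k < c -> - e < h k -> blk k N -> sec (k + len N)%N.
  move=> ac he bl; split; [exact: a_next_lt|exact: h_gt|].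
  by move=> mu1; apply: block_h_le bl.
(* Each block gains one condition of [sec]: first the lower bound on [h], then the bound on [a],
   then the upper bound on [h]. *)
have [k1 hk1] : exists k, - e < h k.
  by have [N /h_gt ?] := bex 0%N; exists (0 + len N)%N.
have [k2 [ak2 hk2]] : exists k, a k < c /\ - e < h k.
  have [N bl] := bex k1; exists (k1 + len N)%N.
  by split; [exact: a_next_lt|exact: h_gt].
have [N0 bl0] := bex k2.
have [||k [N [M [[ak hk bk] blN blM per]]]] :=
  block_tail lam_gt0 mu_gt0 mu_le1 c_ge1 d_ge1 step (sec := sec) _ _
   (sec_next _ _ ak2 hk2 bl0).
- by move=> k N [ak hk _]; exact: sec_next.
- move=> k N M N' [ak hk _] bN bM bN'; apply: (mono ak _ bN bM bN').
  exact: a_next_lt bN.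
have [ak' hk' bk'] := sec_next _ _ ak hk blN.
exists k, (len N + len M)%N; split.
- by [].
- move=> mu1; rewrite mul2n -addnn leq_add // ltnS leq_mul2r; apply/orP; right.
    by apply: block_bound blN (bk mu1).
  by apply: block_bound blM (bk' mu1).
- exact: per.
split=> // z.
have E w : lin_traj t (fun i => J (k + i)%N) w (len N + len M) =
    lin_step t B (lin_step t B w).
  rewrite lin_trajD; case: blN => _ _ JN _ _; case: blM => _ _ JM _ _.
  rewrite (eq_lin_traj _ (J' := block_letter A B M)); last first.
    by move=> i iM; rewrite addnA JM.
  rewrite lin_traj_block (eq_lin_traj _ (J' := block_letter A B N)).
    by rewrite lin_traj_block.
  by move=> i /JN.
by have := B_rot z; cbv beta zeta; rewrite -!E.
Qed.

End ReturnDynamics.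

(** * Monotonicity of the run lengths *)

Section MonotoneReturns.
Variables (R : realType) (lam mu c d e : R).
Variables (a h : nat -> R) (J : nat -> nat) (A : seq nat) (B : nat).
Hypotheses (lam_gt0 : 0 < lam) (lam_le1 : lam <= 1).
Hypotheses (mu_gt0 : 0 < mu) (mu_le1 : mu <= 1) (c_ge1 : 1 <= c).
Hypothesis a_gt0 : forall k, 0 < a k.

Let f x := mu * x - c.
Let g x := mu * x + c.
Let len := block_len A.

(** For [s = 0] already consecutive run lengths decrease: the next height is [lam * g^N a], so [N]
    words bring it down to at most [lam * a], and [lam^2 a < lam^2 c <= d]. *)
Lemma mono_decoupled k N M N' : let blk := block lam mu c d 0 a h J A B in
  lam ^+ 2 * c <= d -> a k < c -> a (k + len N)%N < c ->
  blk k N -> blk (k + len N)%N M -> blk (k + len N + len M)%N N' -> (N' <= N)%N.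
Proof.
move=> blk lcd.
have mon k1 N1 M1 : a k1 < c -> blk k1 N1 -> blk (k1 + len N1)%N M1 -> (M1 <= N1)%N.
  move=> ac b1 b2; apply: (block_leq b2).
  case: b1 => _ _ _ _ ->; rewrite mul0r addr0.
  have le := @iter_f_iter_g _ mu c lam 0 (a k1) N1.
  rewrite !subr0 mu_gt0 lexx (le_trans ler01 c_ge1) (ltW lam_gt0) in le.
  have {}le := le mu_le1 lam_le1 isT (ltW (a_gt0 _)).
  apply: le_lt_trans (_ : lam * (lam * a k1) < _).
    by rewrite ler_pM2l.
  rewrite mulrA -expr2; apply: lt_le_trans lcd.
  by rewrite ltr_pM2l // exprn_gt0.
move=> ac ac' b1 b2 b3; apply: (leq_trans (mon _ _ _ ac' b2 b3)).
exact: mon ac b1 b2.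
Qed.

(** For [s = 1] the sum [a + h] is what one can follow: it is only scaled along a run, and after the
    first block it equals [d - 1 + lam * g^N a], free of the old height. Hence the height two blocks
    later is at most [lam^2 g^N a - e], and [N] words bring it down to at most [lam^2 a - e]. *)
Lemma mono_coupled k N M N' : let blk := block lam mu c d 1 a h J A B in
  1 <= d -> e = 2 - d -> 0 <= e <= c -> lam * (lam ^+ 2 * c - e) <= d ->
  a k < c -> a (k + len N)%N < c ->
  blk k N -> blk (k + len N)%N M -> blk (k + len N + len M)%N N' -> (N' <= N)%N.
Proof.
move=> blk d1 ed ec lcd ac _ b1 b2 b3; apply: (block_leq b3).
case: b2 => _ _ _ _ ->; case: b1 => _ _ _ -> ->.
set gN := iter N g (a k); set fN := iter N f (h k).
have sumE n x y : iter n g x + iter n f y = mu ^+ n * (x + y).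
  elim: n => [|n /= IH]; first by rewrite mul1r.
  by rewrite exprS -mulrA -IH /f /g; ring.
have gN0 : 0 <= gN by apply: iter_g_ge0; rewrite ?(le_trans ler01 c_ge1) // ltW.
have le := @iter_f_iter_g _ mu c (lam ^+ 2) e (a k) N.
rewrite mu_gt0 exprn_ge0 ?exprn_ile1 ?(ltW lam_gt0) // in le.
have {}le := le mu_le1 isT ec (ltW (a_gt0 _)).
set x := iter M _ _; set y := iter M _ _.
have xy : x + y = mu ^+ M * (d - 1 + lam * gN).
  by rewrite /x /y sumE; congr (_ * _); ring.
have hle : lam * x + 1 * (lam * y - 1) <= lam ^+ 2 * gN - e.
  have -> : lam * x + 1 * (lam * y - 1) = lam * (x + y) - 1 by ring.
  have p0 : 0 <= d - 1 + lam * gN by rewrite addr_ge0 ?subr_ge0 // mulr_ge0 // ltW.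
  have mM : mu ^+ M <= 1 by rewrite exprn_ile1 // ltW.
  have : x + y <= d - 1 + lam * gN by rewrite xy ler_piMl.
  rewrite -(ler_pM2l lam_gt0) => le1.
  have : lam * (d - 1) <= d - 1 by rewrite ler_piMl // subr_ge0.
  have E : lam * (d - 1 + lam * gN) = lam * (d - 1) + lam ^+ 2 * gN by ring.
  by rewrite ed; move: le1; rewrite E; lra.
apply: lt_le_trans lcd; rewrite ltr_pM2l //.
apply: le_lt_trans (iter_f_mono c N mu_gt0 hle) _.
apply: le_lt_trans le _; rewrite ltrD2r ltr_pM2l ?exprn_gt0 //.
Qed.
End MonotoneReturns.

(** * The three polygons *)

(** [K] depends on [lam] only, which leaves finitely many eventual codes for [lam < 1]. The value
    [lam = 1], without bound on the period, serves the limit statement. *)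
Definition eventually_contracting (R : realType) (t : R) (n : nat) : Prop :=
  forall lam : R, 0 < lam <= 1 -> exists K : nat, forall J z,
    (forall k, (J k < n)%N) -> admissible t lam J z ->
    exists k m kappa, [/\ (0 < m)%N, lam < 1 -> (m <= K)%N,
      forall i, J (k + i + m)%N = J (k + i)%N
    & contracting t (fun i => J (k + i)%N) m kappa].

(** Letter 2 occurs when [lam * h > 1] and letter 1 when [lam * h < 1]; two letters 1 rotate by
    [-1], so [kappa = 0]. *)
Lemma eventually_contracting_square (R : realType) :
  eventually_contracting (0 : R) 4.
Proof.
move=> lam /andP[l0 l1].
exists (2 * (Num.bound (1 / (1 - lam) + 1 + 1)%R * 1).+1)%N => J z J4 adm.
pose w := traj 0 lam J z.
have wS k : w k.+1 = frame_step 0 lam (J k) (w k) by [].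
have a0 k : 0 < (w k).1 by case: (adm k).
have h0 k : 0 < (w k).2 by case: (adm k).
have J12 k : J k = 1%N \/ J k = 2%N.
  have := h0 k.+1; have := a0 k.+1; rewrite wS; have := J4 k.
  have := mulr_gt0 l0 (h0 k); have := mulr_gt0 l0 (a0 k).
  (* Increments 0 and 3 would make the second coordinate of the next point negative. *)
  case: (J k) => [|[|[|[|?]]]] // ? ? _; rewrite /frame_step /= => ? ?;
    by [exfalso; lra|left|right].
have w1 k : J k = 1%N -> w k.+1 = (1 - lam * (w k).2, lam * (w k).1).
  by rewrite wS => ->; rewrite /frame_step /shift_frame /=; congr pair; ring.
have w2 k : J k = 2%N -> w k.+1 = (1 + lam * (w k).1, lam * (w k).2 - 1).
  by rewrite wS => ->; rewrite /frame_step /shift_frame /=; congr pair; ring.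
have [|||||||||||k [m [m0 mK per ct]]] := @returns_contracting R 0 lam lam 1 1 0 0 0
  (fun k => (w k).1) (fun k => (w k).2) J [:: 2%N] 1 l0 l1 l0 l1.
1-5: try (intros; lra).
- move=> k; have := a0 k.+1; have := h0 k.+1; rewrite addn1.
  case: (J12 k) => Jk; [rewrite (w1 _ Jk)|rewrite (w2 _ Jk)] => /= ? ?; [right|left].
    by split=> //; lra.
  by split; [lra|case=> // _; rewrite addn0|lra|lra].
- by move=> k N _; rewrite oppr0.
- move=> k N M N'; apply: mono_decoupled => //.
  by rewrite mulr1 exprn_ile1 // ltW.
- by move=> [x y]; rewrite /= /lin_step /lin_shift /=; congr pair; ring.
- by lra.
- by move=> [x y]; rewrite /= /lin_step /lin_shift /=; split; ring.
by exists k, m, 0.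
Qed.

(** Here the height is the difference [b - a] of the coordinates. Letter 2 occurs when
    [lam * (b - a) > 1]; it makes the height negative, so letter 1 follows. The word [2 1] takes two
    steps, whence [mu = lam^2] and [c = 1 + lam]. *)
Lemma eventually_contracting_triangle (R : realType) :
  eventually_contracting (-1 : R) 3.
Proof.
move=> lam /andP[l0 l1].
exists (2 * (Num.bound ((1 + lam) / (1 - lam ^+ 2) + 1 + 1)%R * 2).+1)%N => J z J3 adm.
pose w := traj (-1) lam J z.
have wS k : w k.+1 = frame_step (-1) lam (J k) (w k) by [].
have a0 k : 0 < (w k).1 by case: (adm k).
have h0 k : 0 < (w k).2 by case: (adm k).
have mu0 : 0 < lam ^+ 2 by rewrite exprn_gt0.
have mu1 : lam ^+ 2 <= 1 by rewrite exprn_ile1 // ltW.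
have J12 k : J k = 1%N \/ J k = 2%N.
  have := h0 k.+1; rewrite wS; have := J3 k; have := mulr_gt0 l0 (h0 k).
  case: (J k) => [|[|[|?]]] // ? _; rewrite /frame_step /= => ?;
    by [exfalso; lra|left|right].
have w1 k : J k = 1%N -> w k.+1 =
    (1 + lam * (w k).1 - lam * (w k).2, lam * (w k).1).
  by rewrite wS => ->; rewrite /frame_step /shift_frame /=; congr pair; ring.
have w2 k : J k = 2%N -> w k.+1 =
    (lam * (w k).2, lam * (w k).2 - lam * (w k).1 - 1).
  by rewrite wS => ->; rewrite /frame_step /shift_frame /=; congr pair; ring.
have [|||||||||||k [m [m0 mK per ct]]] := @returns_contracting R (-1) lam (lam ^+ 2)
  (1 + lam) 1 1 1 1
  (fun k => (w k).1) (fun k => (w k).2 - (w k).1) J [:: 2%N; 1%N] 1 l0 l1 mu0 mu1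
  .
1-5: try (intros; lra).
- move=> x lx; have : 0 < lam * (lam * x - 1) by rewrite mulr_gt0 // subr_gt0.
  by rewrite expr2; lra.
- move=> k; have [Jk|Jk] := J12 k.
    have := a0 k.+1; have := h0 k.+1; rewrite (w1 _ Jk) /= => ? ?.
    by right; split=> //; lra.
  have wk1 := w2 _ Jk; have := h0 k.+1; rewrite wk1 /= => ?.
  have Jk1 : J k.+1 = 1%N.
    case: (J12 k.+1) => // Jk1; have := h0 k.+2; rewrite (w2 _ Jk1) wk1 /= => ?.
    by have := mulr_gt0 l0 (mulr_gt0 l0 (a0 k)) => ?; exfalso; lra.
  left; rewrite addn2 (w1 _ Jk1) wk1 /=; split; [lra| |lra|lra].
  by case=> [|[|]] // _; rewrite ?addn0 ?addn1.
- move=> k N [_ _ JN _ _]; rewrite addnS (w1 (k + N * 2)%N) /=.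
    have := mulr_gt0 l0 (h0 (k + N * 2)%N); have := mulr_gt0 l0 (a0 (k + N * 2)%N).
    lra.
  by rewrite JN // /block_letter ltnn.
- move=> k N M N'; apply: mono_coupled => //; try lra.
  have l3 : lam * lam ^+ 2 <= 1 by rewrite -exprS exprn_ile1 // ltW.
  have l4 : lam * (lam * lam ^+ 2) <= lam by rewrite ler_piMr // ltW.
  lra.
- by move=> [x y]; rewrite /= /lin_step /lin_shift /=; congr pair; ring.
- by lra.
- by move=> [x y]; rewrite /= /lin_step /lin_shift /=; split; ring.
exists k, m, 1; split=> // lam1; apply: mK.
by rewrite exprn_ilt1 // ltW.
Qed.

(** An orbit that meets letter 1 has the tail [1 1 1 ...], of period 1 and with rotation of order 3.
    Otherwise letter 3 occurs when [lam * h > 2] and letter 2 when [lam * h < 2]. *)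
Lemma eventually_contracting_hexagon (R : realType) :
  eventually_contracting (1 : R) 6.
Proof.
move=> lam /andP[l0 l1].
exists (2 * (Num.bound (2 / (1 - lam) + 2 + 1)%R * 1).+1)%N => J z J6 adm.
pose w := traj 1 lam J z.
have wS k : w k.+1 = frame_step 1 lam (J k) (w k) by [].
have a0 k : 0 < (w k).1 by case: (adm k).
have h0 k : 0 < (w k).2 by case: (adm k).
have J123 k : [\/ J k = 1%N, J k = 2%N | J k = 3%N].
  have := h0 k.+1; have := a0 k.+1; rewrite wS; have := J6 k.
  have := mulr_gt0 l0 (h0 k); have := mulr_gt0 l0 (a0 k).
  case: (J k) => [|[|[|[|[|[|?]]]]]] // ? ? _; rewrite /frame_step /= => ? ?;
    by [exfalso; lra|constructor].
have w1 k : J k = 1%N -> w k.+1 =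
    (1 - lam * (w k).1 - lam * (w k).2, lam * (w k).1).
  by rewrite wS => ->; rewrite /frame_step /shift_frame /=; congr pair; ring.
have w2 k : J k = 2%N -> w k.+1 =
    (2 - lam * (w k).2, lam * (w k).1 + lam * (w k).2 - 1).
  by rewrite wS => ->; rewrite /frame_step /shift_frame /=; congr pair; ring.
have w3 k : J k = 3%N -> w k.+1 = (2 + lam * (w k).1, lam * (w k).2 - 2).
  by rewrite wS => ->; rewrite /frame_step /shift_frame /=; congr pair; ring.
have [[k Jk]|no1] := pselect (exists k, J k = 1%N).
  have J1 i : J (k + i)%N = 1%N.
    elim: i => [|i IH]; first by rewrite addn0.
    rewrite addnS; move: (k + i)%N IH => j Jj.
    (* After a letter 1 the coordinates have sum less than 1, whereas letter 2 needs
       [lam * (a + b) > 1] and letter 3 needs [lam * b > 2]. *)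
    have := a0 j.+2; have := h0 j.+2; have := a0 j.+1; have := h0 j.+1.
    have := mulr_gt0 l0 (a0 j); have := mulr_gt0 l0 (h0 j).
    have := mulr_gt0 l0 (a0 j.+1); have := mulr_gt0 l0 (h0 j.+1).
    case: (J123 j.+1) => // Jj1; rewrite ?(w2 _ Jj1) ?(w3 _ Jj1) (w1 _ Jj) /=.
    - move: (w j) => [x y] /= *; exfalso; nra.
    - move: (w j) => [x y] /= *; exfalso; nra.
  exists k, 1%N, 1; split=> // [i|]; first by rewrite -!addnA !J1.
  by split=> // -[x y]; rewrite /= !J1 /lin_step /lin_shift /=; split; ring.
have [|||||||||||k [m [m0 mK per ct]]] := @returns_contracting R 1 lam lam 2 2 1 0 1
  (fun k => (w k).1) (fun k => (w k).2) J [:: 3%N] 2 l0 l1 l0 l1.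
1-5: try (intros; lra).
- move=> k; have := a0 k; have := h0 k; have := a0 k.+1; have := h0 k.+1.
  rewrite addn1; case: (J123 k) => Jk.
  + by case: no1; exists k.
  + by rewrite (w2 _ Jk) /= => *; right; split=> //; lra.
  + rewrite (w3 _ Jk) /= => *; left; split; [lra| |lra|lra].
    by case=> // _; rewrite addn0.
- by move=> k N _; rewrite oppr0.
- move=> k N M N'; apply: mono_coupled => //; try lra.
  have : lam * lam ^+ 2 <= 1 by rewrite -exprS exprn_ile1 // ltW.
  lra.
- by move=> [x y]; rewrite /= /lin_step /lin_shift /=; congr pair; ring.
- by lra.
- by move=> [x y]; rewrite /= /lin_step /lin_shift /=; split; ring.
by exists k, m, 1.
Qed.

(** * From the plane to vertex coordinates *)

Lemma polygon_affine_ge0 (R : realType) n (v : 'I_n -> plane R) (A B C : R) :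
  (forall i, 0 <= A * (v i).1 + B * (v i).2 + C) ->
  forall p, polygon v p -> 0 <= A * p.1 + B * p.2 + C.
Proof.
move=> vge p [w [w0 w1 ->]].
have -> : (\sum_(i < n) w i *: v i).1 = \sum_(i < n) w i * (v i).1.
  exact: (big_morph (fun q : plane R => q.1)).
have -> : (\sum_(i < n) w i *: v i).2 = \sum_(i < n) w i * (v i).2.
  exact: (big_morph (fun q : plane R => q.2)).
rewrite -[C]mul1r -w1 mulr_suml !mulr_sumr -!big_split /=.
apply: sumr_ge0 => i _.
have -> : A * (w i * (v i).1) + B * (w i * (v i).2) + w i * C =
  w i * (A * (v i).1 + B * (v i).2 + C) by ring.
by rewrite mulr_ge0.
Qed.

Lemma segment_polygon (R : realType) n (v : 'I_n -> plane R) i j (b : R) :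
  0 <= b <= 1 ->
  polygon v ((1 - b) * (v i).1 + b * (v j).1, (1 - b) * (v i).2 + b * (v j).2).
Proof.
move=> /andP[b0 b1].
have pick1 (q : 'I_n -> R) k : \sum_(l < n) (l == k)%:R * q l = q k.
  rewrite (bigD1 k) //= eqxx mul1r big1 ?addr0 // => l /negbTE ->.
  by rewrite mul0r.
exists (fun l => (l == i)%:R * (1 - b) + (l == j)%:R * b); split.
- by move=> l; rewrite addr_ge0 // mulr_ge0 // subr_ge0.
- by rewrite big_split /= !pick1; lra.
- apply: injective_projections => /=.
  + rewrite (big_morph (fun q : plane R => q.1) (id1 := 0) (op1 := +%R)) //=.
    under eq_bigr do rewrite /GRing.scale /= mulrDl -!mulrA.
    by rewrite big_split /= !pick1.
  + rewrite (big_morph (fun q : plane R => q.2) (id1 := 0) (op1 := +%R)) //=.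
    under eq_bigr do rewrite /GRing.scale /= mulrDl -!mulrA.
    by rewrite big_split /= !pick1.
Qed.

(* [u k] is the vector from the centre to vertex [k]. *)
Definition lattice_frame (R : realType) (n : nat) (t : R) (v : 'I_n -> plane R)
    (c : plane R) (u : nat -> plane R) : Prop :=
  [/\ [\/ n = 3%N /\ t = -1, n = 4%N /\ t = 0 | n = 6%N /\ t = 1],
      forall k, u k.+2 = (t * (u k.+1).1 - (u k).1, t * (u k.+1).2 - (u k).2),
      0 < cross (u 0%N) (u 1%N), forall k, u (k + n)%N = u k
    & forall i : 'I_n, v i = (c.1 + (u i).1, c.2 + (u i).2)].

Section Coordinates.
Variables (R : realType) (n : nat) (t : R) (v : 'I_n -> plane R).
Variables (c : plane R) (u : nat -> plane R).
Hypothesis fr : lattice_frame t v c u.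

Let nt : [\/ n = 3%N /\ t = -1, n = 4%N /\ t = 0 | n = 6%N /\ t = 1].
Proof. by case: fr. Qed.

Let n_gt0 : (0 < n)%N. Proof. by case: nt => -[-> _]. Qed.
Let n_gt1 : (1 < n)%N. Proof. by case: nt => -[-> _]. Qed.

Let uSS k : u k.+2 = (t * (u k.+1).1 - (u k).1, t * (u k.+1).2 - (u k).2).
Proof. by case: fr. Qed.

Let cross_u k : cross (u k) (u k.+1) = cross (u 0%N) (u 1%N).
Proof. by elim: k => // k <-; rewrite uSS /cross /=; ring. Qed.

Let cross_u_gt0 k : 0 < cross (u k) (u k.+1).
Proof. by rewrite cross_u; case: fr. Qed.

Let u_addn k : u (k + n)%N = u k. Proof. by case: fr. Qed.

Let u_addMn k m : u (k + m * n)%N = u k.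
Proof. by elim: m => [|m IH]; rewrite ?addn0 // mulSn addnCA addnC u_addn. Qed.

Let u_modn k : u (k %% n)%N = u k.
Proof. by rewrite [in RHS](divn_eq k n) addnC u_addMn. Qed.

Definition vertex_label (k : nat) : 'I_n := Ordinal (ltn_pmod k n_gt0).

Let v_label k : v (vertex_label k) = (c.1 + (u k).1, c.2 + (u k).2).
Proof. by case: fr => _ _ _ _ ->; rewrite /= u_modn. Qed.

(* [k * n.-1] stands for [- k] modulo [n]. *)
Definition label_gap (k j : nat) : nat := ((j + k * n.-1) %% n)%N.

Let label_gapE k j : ((k + label_gap k j) %% n = j %% n)%N.
Proof.
rewrite /label_gap modnDmr addnCA.
have -> : (k + k * n.-1 = k * n)%N by rewrite -mulnS prednK.
by rewrite addnC modnMDl.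
Qed.

Let label_gap_lt k j : (label_gap k j < n)%N. Proof. exact: ltn_pmod. Qed.

Let t_lt2 : 0 < 2 - t.
Proof. by case: nt => -[_ ->]; lra. Qed.

Let u_pred k : u (k + n.-1)%N = (t * (u k).1 - (u k.+1).1, t * (u k).2 - (u k.+1).2).
Proof.
have := uSS (k + n.-1); rewrite -!addnS prednK // u_addn addnS -addSn u_addn.
move=> /(congr1 (fun p => (p.1, p.2))) /= -[e1 e2].
by apply: injective_projections => /=; rewrite ?e1 ?e2; ring.
Qed.

(** Write [j] as [k + m] modulo [n] with [m < n]; the recurrence reduces each case to the sign of
    [cross (u k) (u k.+1)]. *)
Let edge_ge0 k j : 0 <= cross (u k.+1 - u k) (u j - u k).
Proof.
rewrite -(u_modn j) -(label_gapE k j) u_modn.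
have uS := uSS; have cr := cross_u_gt0 k.
have := label_gap_lt k j; move: (label_gap k j) => m.
case: nt => -[en et]; rewrite en => m_lt; rewrite et in uS;
  case: m m_lt => [|[|[|[|[|[|//]]]]]] // _; move: cr;
  rewrite ?addnS ?addn0 ?uS /cross /= => cr; lra.
Qed.

(** The point [v_k - z.1 e_(k-1) - z.2 e_k]; the recurrence turns [e_(k-1)] into
    [(1 - t) u_k + u_(k+1)], which avoids the index [k - 1]. *)
Definition pt (k : nat) (z : R * R) : plane R :=
  (c.1 + (u k).1 - z.1 * ((1 - t) * (u k).1 + (u k.+1).1)
    - z.2 * ((u k.+1).1 - (u k).1),
   c.2 + (u k).2 - z.1 * ((1 - t) * (u k).2 + (u k.+1).2)
    - z.2 * ((u k.+1).2 - (u k).2)).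

Lemma pt_shift k z : pt k.+1 (shift_frame t z) = pt k z.
Proof. by rewrite /pt uSS /=; congr pair; ring. Qed.

Lemma pt_iter k j z : pt (k + j)%N (iter j (shift_frame t) z) = pt k z.
Proof. by elim: j => [|j IH]; rewrite ?addn0 // addnS /= pt_shift. Qed.

Lemma pt_modn k z : pt (k %% n)%N z = pt k z.
Proof.
by rewrite /pt u_modn -[in u (k %% n).+1]u_modn -addn1 modnDml addn1 u_modn.
Qed.

Lemma vertexE k : v (vertex_label k) = pt k (0, 0).
Proof. by rewrite v_label /pt /= !mul0r !subr0. Qed.

(** Cramer's rule; the determinant of [e_(k-1)], [e_k] is [(2 - t) * cross (u k) (u k.+1)]. *)
Lemma pt_inj k z z' : pt k z = pt k z' -> z = z'.
Proof.
move=> /(congr1 (fun p => (p.1, p.2))) /= -[e1 e2].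
have D : (2 - t) * cross (u k) (u k.+1) != 0.
  by rewrite mulf_neq0 // gt_eqF.
apply: injective_projections; apply: (mulfI D); rewrite /cross /=.
  have := congr1 (fun x => x * ((u k.+1).2 - (u k).2)) e1.
  have := congr1 (fun x => x * ((u k.+1).1 - (u k).1)) e2.
  by move=> f1 f2; lra.
have := congr1 (fun x => x * ((1 - t) * (u k).2 + (u k.+1).2)) e1.
have := congr1 (fun x => x * ((1 - t) * (u k).1 + (u k.+1).1)) e2.
by move=> f1 f2; lra.
Qed.

Lemma pt_surj k x : exists z, x = pt k z.
Proof.
have D : (2 - t) * cross (u k) (u k.+1) != 0.
  by rewrite mulf_neq0 // gt_eqF.
set D0 := (_ * _) in D.
exists ((((u k.+1).1 - (u k).1) * (x.2 - c.2 - (u k).2) -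
         ((u k.+1).2 - (u k).2) * (x.1 - c.1 - (u k).1)) / D0,
        (((1 - t) * (u k).2 + (u k.+1).2) * (x.1 - c.1 - (u k).1) -
         ((1 - t) * (u k).1 + (u k.+1).1) * (x.2 - c.2 - (u k).2)) / D0).
have E : D0 = (2 - t) * ((u k).1 * (u k.+1).2 - (u k).2 * (u k.+1).1) by [].
have H a p q w w' :
    D0 * (a - p / D0 * w - q / D0 * w') = D0 * a - p * w - q * w'.
  by field; exact: D.
by apply: injective_projections; rewrite /pt /=; apply: (mulfI D);
  rewrite H E; ring.
Qed.

Let D k : R := (2 - t) * cross (u k) (u k.+1).

Let D_gt0 k : 0 < D k. Proof. by rewrite mulr_gt0. Qed.

Let polygon_edge k p : polygon v p ->
  0 <= cross (u k.+1 - u k) (p - v (vertex_label k)).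
Proof.
rewrite v_label => pp.
have := @polygon_affine_ge0 R n v (- (u k.+1 - u k).2) (u k.+1 - u k).1
  (- cross (u k.+1 - u k) (c + u k)) _ _ pp.
rewrite /cross /= => H; apply: le_trans (H _) _; last by rewrite le_eqVlt; apply/orP; left; apply/eqP; ring.
move=> i; have -> : v i = (c.1 + (u i).1, c.2 + (u i).2) by case: fr.
by have := edge_ge0 k i; rewrite /cross /= => e; apply: le_trans e _; rewrite le_eqVlt; apply/orP; left; apply/eqP; ring.
Qed.

(** Up to the positive factor [D k], [z.1] and [- z.2] measure the position relative to the lines of
    the two sides at vertex [k]. *)
Lemma polygon_pt k z : polygon v (pt k z) -> 0 <= z.1 /\ z.2 <= 0.
Proof.
move=> pz; split.
  have := polygon_edge k pz.
  have -> : cross (u k.+1 - u k) (pt k z - v (vertex_label k)) = z.1 * D k.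
    by rewrite vertexE /D /pt /cross /=; ring.
  by rewrite pmulr_lge0.
(* Replacing [k] by [k + n] makes the previous side available with a natural index. *)
rewrite -(pt_modn k) -(modnDr k n) pt_modn in pz.
have := polygon_edge (k + n.-1) pz.
rewrite -addnS prednK // u_addn u_pred.
have -> : cross (u k - (t * (u k).1 - (u k.+1).1, t * (u k).2 - (u k.+1).2))
   (pt (k + n) z - v (vertex_label (k + n.-1))) = - z.2 * D k.
  rewrite v_label u_pred -[pt (k + n) z]pt_modn modnDr pt_modn.
  by rewrite /D /pt /cross /=; ring.
by rewrite pmulr_lge0 // oppr_ge0.
Qed.

(** One direction tests the two neighbours of vertex [k]. For the other, the ray has direction
    [z.1 e_(k-1) + z.2 e_k], and the polygon is to the left of both sides. *)
Lemma left_of_ray_pt k z :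
  left_of_ray v (pt k z) (vertex_label k) <-> 0 <= z.1 /\ 0 <= z.2.
Proof.
have vpoly i : polygon v (v i).
  have := @segment_polygon R n v i i 0; rewrite lexx ler01 => /(_ isT).
  by rewrite subr0 !mul1r !mul0r !addr0; case: (v i).
split=> [left|[z1 z2] p pp].
  split.
    have := left _ (vpoly (vertex_label k.+1)).
    have -> : cross (v (vertex_label k) - pt k z) (v (vertex_label k.+1) - pt k z)
        = z.1 * D k.
      by rewrite !v_label /D /pt /cross /=; ring.
    by rewrite pmulr_lge0.
  have := left _ (vpoly (vertex_label (k + n.-1))).
  have -> : cross (v (vertex_label k) - pt k z)
      (v (vertex_label (k + n.-1)) - pt k z) = z.2 * D k.
    by rewrite !v_label u_pred /D /pt /cross /=; ring.
  by rewrite pmulr_lge0.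
have e1 := polygon_edge k pp.
have e2 := polygon_edge (k + n.-1) pp.
rewrite -addnS prednK // u_addn in e2.
have -> : cross (v (vertex_label k) - pt k z) (p - pt k z) =
  z.1 * cross (u k - u (k + n.-1)%N) (p - v (vertex_label (k + n.-1))) +
  z.2 * cross (u k.+1 - u k) (p - v (vertex_label k)).
  by rewrite !v_label u_pred /pt /cross /=; ring.
by rewrite addr_ge0 // mulr_ge0.
Qed.

(** In the frame of vertex [k + m] the point has coordinates [S^m z], outside the closed quadrant
    for [0 < m < n]. *)
Lemma left_of_ray_uniq k z j : quadrant z ->
  left_of_ray v (pt k z) j -> j = vertex_label k.
Proof.
move=> [z1 z2]; set m := label_gap k j.
have -> : j = vertex_label (k + m).
  by apply: val_inj; rewrite /= label_gapE modn_small.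
rewrite -(pt_iter k m) left_of_ray_pt.
have := label_gap_lt k j; rewrite -/m; move: m => m.
case: (posnP m) => [->|m0 mn le]; first by rewrite addn0.
exfalso; move: m0 mn le; case: z z1 z2 => x y /= x0 y0.
case: nt => -[-> ->]; case: m => [|[|[|[|[|[|//]]]]]] // _ _;
  rewrite /shift_frame /= => -[? ?]; lra.
Qed.

Lemma refl_vertex_pt k z : quadrant z ->
  refl_vertex v (pt k z) = Some (vertex_label k).
Proof.
move=> qz; rewrite /refl_vertex; case: pickP => [i /asboolP|].
  by move=> /(left_of_ray_uniq qz) ->.
move=> /(_ (vertex_label k)) /asboolP[]; apply/left_of_ray_pt.
by case: qz => *; rewrite !ltW.
Qed.

Lemma pt_nonsingular k z : quadrant z -> ~ singular_set v (pt k z).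
Proof.
move=> qz [_]; apply; exists (vertex_label k); split.
  by apply/left_of_ray_pt; case: qz => *; rewrite !ltW.
by move=> j /(left_of_ray_uniq qz).
Qed.

Lemma pt_outside k z : quadrant z -> ~ polygon v (pt k z).
Proof. by move=> [_ z2] /polygon_pt[_]; rewrite leNgt z2. Qed.

(** If [z.1 = 0], the next vertex would serve as well. If [z.2 = 0], either the previous vertex
    would serve too ([1 <= z.1]) or [x] would lie on a side of the polygon. *)
Lemma outside_nonsingular_pt x : ~ polygon v x -> ~ singular_set v x ->
  exists k z, x = pt k z /\ quadrant z.
Proof.
move=> xP xS; have [i [ileft iuniq]] : exists! i, left_of_ray v x i.
  by apply: contrapT => H; apply: xS; split.
have ei : i = vertex_label i by apply: val_inj; rewrite /= modn_small.
have [z xz] := pt_surj i x; exists i, z; split=> //.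
rewrite {1}ei xz in ileft; have /left_of_ray_pt[z1 z2] := ileft.
have lab_neq m : (0 < m < n)%N -> i <> vertex_label (i + m).
  move=> /andP[m0 mn] /(congr1 val) /= /eqP.
  rewrite -{1}(modn_small (ltn_ord i)) -[X in (X %% n)%N == _]addn0 eqn_modDl.
  by rewrite mod0n modn_small // eq_sym gtn_eqF.
have z1n0 : z.1 != 0.
  apply/eqP => z10; apply: (lab_neq 1%N n_gt1); apply: iuniq.
  rewrite xz -pt_shift addn1; apply/left_of_ray_pt; rewrite /= z10.
  by split; lra.
have z2n0 : z.2 != 0.
  apply/eqP => z20.
  have xz' : x = pt (i + n.-1) (0, z.1 - 1).
    rewrite xz -(pt_shift (i + n.-1)) -addnS prednK // -[RHS]pt_modn modnDr pt_modn.
    by congr pt; apply: injective_projections; rewrite /= ?z20; ring.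
  have [z11|z11] := leP 1 z.1.
    apply: (lab_neq n.-1); first by have := n_gt1; lia.
    by apply: iuniq; rewrite xz'; apply/left_of_ray_pt; split => //=; lra.
  apply: xP; rewrite xz.
  have := @segment_polygon R n v (vertex_label i) (vertex_label (i + n.-1)) z.1.
  rewrite z1 ltW // => /(_ isT); rewrite !v_label u_pred /pt /= z20.
  by congr (polygon v _); congr pair; ring.
by split; rewrite lt_neqAle eq_sym ?z1n0 ?z2n0.
Qed.

Lemma billiard_pt lam k z : quadrant z ->
  billiard v lam (pt k z) = pt k (- (lam * z.1), - (lam * z.2)).
Proof.
move=> qz; rewrite /billiard refl_vertex_pt // v_label /pt.
by apply: injective_projections => /=; rewrite /GRing.scale /=; ring.
Qed.

Lemma iter_billiard_pt lam J k z q : admissible t lam J z ->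
  iter q (billiard v lam) (pt k z) =
  pt (k + \sum_(i < q) J i) (traj t lam J z q).
Proof.
move=> adm; elim: q => [|q IH]; first by rewrite big_ord0 addn0.
by rewrite big_ord_recr /= IH billiard_pt // addnA pt_iter.
Qed.

Lemma billiard_domain_pt lam J k z : admissible t lam J z ->
  billiard_domain v lam (pt k z).
Proof.
move=> adm [/(pt_outside (adm 0%N))//|[q _]] /=.
by rewrite (iter_billiard_pt _ _ adm); exact: pt_nonsingular.
Qed.

Lemma billiard_code_pt lam J k z q : admissible t lam J z ->
  billiard_code v lam (pt k z) q = Some (vertex_label (k + \sum_(i < q) J i)).
Proof.
by move=> adm; rewrite /billiard_code (iter_billiard_pt _ _ adm) refl_vertex_pt.
Qed.

Lemma billiard_domain_coding lam x : 0 < lam -> billiard_domain v lam x ->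
  exists k z J, [/\ x = pt k z, forall q, (J q < n)%N & admissible t lam J z].
Proof.
move=> lam0 xdom.
have xP : ~ polygon v x by move=> xP; apply: xdom; left.
have xS q : ~ singular_set v (iter q (billiard v lam) x).
  by move=> xS; apply: xdom; right; exists q.
have xq q : exists p : nat * (R * R),
    iter q (billiard v lam) x = pt p.1 p.2 /\ quadrant p.2.
  suff /outside_nonsingular_pt : ~ polygon v (iter q (billiard v lam) x).
    by move=> /(_ (xS q))[k [z xkz]]; exists (k, z).
  (* A reflected point has first coordinate [- lam * z.1 < 0], so it is again outside the
     polygon. *)
  elim: q => // q IH; have [k [z [E qz]]] := outside_nonsingular_pt IH (xS q).
  rewrite iterS E billiard_pt // => /polygon_pt[/=].
  by rewrite oppr_ge0 leNgt mulr_gt0 //; case: qz.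
have [f fP] := choice xq.
pose J q := label_gap (f q).1 (f q.+1).1.
have trajE q : traj t lam J (f 0%N).2 q = (f q).2.
  elim: q => //= q ->; apply: (@pt_inj (f q.+1).1).
  have [_ qz] := fP q; have [<- _] := fP q.+1; have [E _] := fP q.
  rewrite iterS E billiard_pt // -pt_modn -(label_gapE (f q).1) pt_modn.
  by rewrite pt_iter.
exists (f 0%N).1, (f 0%N).2, J; split.
- by case: (fP 0%N).
- by move=> q; exact: label_gap_lt.
- by move=> q; rewrite trajE; case: (fP q).
Qed.

End Coordinates.

(** * Regular polygons and their vertex recurrence *)

Section RegularFrame.
Variable R : realType.

Lemma cos_2pi_3 : 2 * cos (2 * pi / 3) = -1 :> R.
Proof.
have e : 2 * pi / 3 = pi - pi / 3 :> R by field.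
have c3 : 2 * cos (pi / 3) = 1 :> R.
  set x : R := cos (pi / 3).
  have x0 : 0 < x.
    by apply: cos_gt0_pihalf; have := pi_gt0 R => ?; apply/andP; split; lra.
  have : cos (pi / 3 + pi / 3 + pi / 3) = -1 :> R.
    by rewrite -[RHS]cospi; congr cos; field.
  rewrite !cosD sinD -/x; set y := sin _ => E.
  have xy : x ^+ 2 + y ^+ 2 = 1 by exact: cos2Dsin2.
  (* This is the triple angle equation [4 x^3 - 3 x = -1], factored. *)
  have : (x + 1) * (2 * x - 1) ^+ 2 = 0.
    have y2 : y ^+ 2 = 1 - x ^+ 2 by rewrite -xy; ring.
    have : x * x * x - 3 * (x * y ^+ 2) = -1 by rewrite -E; ring.
    by rewrite y2 => E2; lra.
  move/eqP; rewrite mulf_eq0 expf_eq0 /= => /orP[/eqP|/eqP]; lra.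
by rewrite e cosB cospi sinpi mul0r addr0 mulN1r mulrN c3.
Qed.

Lemma cos_2pi_6 : 2 * cos (2 * pi / 6) = 1 :> R.
Proof.
have e : 2 * pi / 6 = pi - 2 * pi / 3 :> R by field.
by rewrite e cosB cospi sinpi mul0r addr0 mulN1r mulrN cos_2pi_3 opprK.
Qed.

Lemma regular_lattice_frame (n : nat) (v : 'I_n -> plane R) :
  n \in [:: 3%N; 4%N; 6%N] -> regular_polygon v ->
  exists t c u, lattice_frame t v c u.
Proof.
move=> hn [c [r [theta [r0 vE]]]].
pose d : R := 2 * pi / n%:R.
have n0 : 0 < n%:R :> R by rewrite ltr0n; move: hn; rewrite !inE; lia.
pose al k := theta + 2 * pi * k%:R / n%:R.
have alS k : al k.+1 = al k + d by rewrite /al /d -natr1; field; rewrite gt_eqF.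
have rec k : cos (al k.+2) = 2 * cos d * cos (al k.+1) - cos (al k) /\
    sin (al k.+2) = 2 * cos d * sin (al k.+1) - sin (al k).
  have -> : al k = al k.+1 - d by rewrite alS addrK.
  by rewrite (alS k.+1) cosB sinB cosD sinD; split; ring.
exists (2 * cos d), c, (fun k => (r * cos (al k), r * sin (al k))); split.
- move: hn; rewrite !inE => /or3P[] /eqP en; rewrite /d en.
  + by apply: Or31; rewrite cos_2pi_3.
  + apply: Or32; split=> //; have -> : 2 * pi / 4 = pi / 2 :> R by field.
    by rewrite cos_pihalf mulr0.
  + by apply: Or33; rewrite cos_2pi_6.
- by move=> k; have [-> ->] := rec k; congr pair => /=; ring.
- have -> : cross (r * cos (al 0%N), r * sin (al 0%N))
      (r * cos (al 1%N), r * sin (al 1%N)) = r ^+ 2 * sin (al 1%N - al 0%N).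
    by rewrite sinB /cross /=; ring.
  rewrite alS addrAC subrr add0r mulr_gt0 ?exprn_gt0 //.
  have p0 := pi_gt0 R; apply: sin_gt0_pi; rewrite divr_gt0 ?mulr_gt0 //=.
  rewrite ltr_pdivrMr // mulrC ltr_pM2l // ltr_nat.
  by move: hn; rewrite !inE; lia.
- move=> k; have -> : al (k + n)%N = al k + pi *+ 2.
    by rewrite /al natrD mulr2n; field; rewrite gt_eqF.
  by rewrite cosD2pi sinD2pi.
- by move=> i; rewrite vE.
Qed.

End RegularFrame.

(** * Periodic orbits *)

Section Limits.
Variables (R : realType) (t : R) (J : nat -> nat).

Lemma cvg_traj (w : R -> R * R) (l : R) k :
  (w x).1 @[x --> l] --> (w l).1 -> (w x).2 @[x --> l] --> (w l).2 ->
  (traj t x J (w x) k).1 @[x --> l] --> (traj t l J (w l) k).1 /\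
  (traj t x J (w x) k).2 @[x --> l] --> (traj t l J (w l) k).2.
Proof.
move=> w1 w2; elim: k => //= k [IH1 IH2]; rewrite /frame_step.
elim: (J k) => [|j [H1 H2]] /=; split.
- by apply: cvgN; apply: cvgM => //; exact: cvg_id.
- by apply: cvgN; apply: cvgM => //; exact: cvg_id.
- by apply: cvgD => //; apply: cvgD; [exact: cvg_cst|apply: cvgM => //; exact: cvg_cst].
- exact: cvgN.
Qed.

Lemma cvg_cycle_point m kappa z (l : R) : 0 < l -> 0 <= kappa ->
  (cycle_point t x J m kappa z).1 @[x --> l] --> (cycle_point t l J m kappa z).1 /\
  (cycle_point t x J m kappa z).2 @[x --> l] --> (cycle_point t l J m kappa z).2.
Proof.
move=> l0 k0.
have cX j : x ^+ j @[x --> l] --> l ^+ j by exact: exprn_continuous.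
have cL j : (x ^+ m) ^+ j @[x --> l] --> (l ^+ m) ^+ j.
  by under eq_fun do rewrite -exprM; rewrite -exprM; exact: cX.
have cW : ((x ^+ m) ^+ 2 + x ^+ m + kappa)^-1 @[x --> l] -->
    ((l ^+ m) ^+ 2 + l ^+ m + kappa)^-1.
  apply: cvgV; first by rewrite gt_eqF // ltr_wpDr // addr_gt0 // !exprn_gt0.
  by apply: cvgD; [apply: cvgD|exact: cvg_cst].
have cst (y : R) : y @[_ --> l] --> y by exact: cvg_cst.
have cz j := @cvg_traj (fun=> z) l j (cst _) (cst _).
split; rewrite /cycle_point /comb3 /=.
  apply: cvgD; first apply: cvgD.
  - by apply: cvgM => //; apply: cvgM.
  - by apply: cvgM; [apply: cvgM|case: (cz m)].
  - by apply: cvgM; [apply: cvgM|case: (cz (m + m)%N)].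
apply: cvgD; first apply: cvgD.
- by apply: cvgM => //; apply: cvgM.
- by apply: cvgM; [apply: cvgM|case: (cz m)].
- by apply: cvgM; [apply: cvgM|case: (cz (m + m)%N)].
Qed.

(** Positivity is an open condition, and by periodicity it has to be checked only at the times
    [k < m], so finitely many neighbourhoods suffice. *)
Lemma cycle_point_admissible_near m kappa z (l : R) : 0 < l -> (0 < m)%N ->
  (forall i, J (i + m)%N = J i) -> contracting t J m kappa ->
  admissible t l J z ->
  \forall x \near l, admissible t x J (cycle_point t x J m kappa z).
Proof.
move=> l0 m0 per ct adm.
have [c1 c2] := cvg_cycle_point m z l0 ct.1.
have near_quad k : \forall x \near l,
    quadrant (traj t x J (cycle_point t x J m kappa z) k).
  have [d1 d2] := cvg_traj k c1 c2.
  have [q1 q2] := cycle_point_admissible l0 per ct adm k.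
  near=> x; split.
    by near: x; exact: (cvgr_gt _ d1).
  by near: x; exact: (cvgr_gt _ d2).
have near_all : \forall x \near l, forall k, (k < m)%N ->
    quadrant (traj t x J (cycle_point t x J m kappa z) k).
  elim: {1 3}m => [|j IH]; first by near=> x.
  near=> x => k; rewrite ltnS leq_eqVlt => /orP[/eqP->|].
    by near: x; exact: near_quad.
  by move: k; near: x.
near=> x => k; have x0 : 0 < x by near: x; exact: lt_nbhsr.
rewrite (divn_eq k m) addnC traj_cycle_point //.
have := ltn_pmod k m0; move: (k %% m)%N; near: x.
exact: near_all.
Unshelve. all: by end_near. Qed.

End Limits.

(** * Orbits with equal codes *)

Section SameCode.
Variables (R : realType) (n : nat) (v : 'I_n -> plane R) (lam : R).
Let T := billiard v lam.

Lemma eucl_dist_ge0 (x y : plane R) : 0 <= eucl_dist x y.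
Proof. exact: sqrtr_ge0. Qed.

Lemma eucl_dist_eq0 (x y : plane R) : eucl_dist x y = 0 -> x = y.
Proof.
move=> /eqP; rewrite sqrtr_eq0 => le0.
have p1 := sqr_ge0 (x.1 - y.1); have p2 := sqr_ge0 (x.2 - y.2).
apply: injective_projections; apply/eqP; rewrite -subr_eq0 -sqrf_eq0; apply/eqP;
  by apply: le_anti; apply/andP; split => //; lra.
Qed.

(** Both points are reflected on the same vertex at each time, and this reflection is a homothety of
    ratio [- lam]. *)
Lemma eucl_dist_iter_same_code x y q : 0 <= lam ->
  billiard_code v lam x =1 billiard_code v lam y ->
  (forall k, billiard_code v lam x k != None) ->
  eucl_dist (iter q T x) (iter q T y) = lam ^+ q * eucl_dist x y.
Proof.
move=> lam0 xy xN; elim: q => [|q IH]; first by rewrite mul1r.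
rewrite exprS -mulrA -IH !iterS.
have TE w : T w = if refl_vertex v w is Some i then v i - lam *: (w - v i) else w by [].
rewrite (TE (iter q T x)) (TE (iter q T y)).
have := xN q; have := xy q; rewrite /billiard_code -/T => <-.
case: (refl_vertex v (iter q T x)) => // i _.
rewrite /eucl_dist -[in RHS](ger0_norm lam0) -sqrtr_sqr -sqrtrM ?sqr_ge0 //.
by congr Num.sqrt; rewrite /= /GRing.scale /=; ring.
Qed.

(** After the common period [p * q] the distance is unchanged, yet multiplied by
    [lam ^+ (p * q) < 1]. *)
Lemma periodic_same_code_eq x y : 0 <= lam < 1 ->
  billiard_code v lam x =1 billiard_code v lam y ->
  (forall k, billiard_code v lam x k != None) ->
  periodic_point v lam x -> periodic_point v lam y -> x = y.
Proof.
move=> /andP[lam0 lam1] xy xN [_ [p p0 px]] [_ [q q0 qy]].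
have iterM r w j : iter r T w = w -> iter (j * r) T w = w.
  by move=> rw; elim: j => // j IH; rewrite mulSn iterD IH.
have := eucl_dist_iter_same_code (p * q) lam0 xy xN.
rewrite [in iter _ _ x]mulnC !iterM // => E; apply: eucl_dist_eq0.
have : lam ^+ (p * q) < 1 by rewrite exprn_ilt1 // muln_eq0 negb_or -!lt0n p0.
have := eucl_dist_ge0 x y; nra.
Qed.

Lemma attracted_same_code x y N : 0 <= lam < 1 ->
  billiard_code v lam (iter N T x) =1 billiard_code v lam y ->
  (forall k, billiard_code v lam y k != None) ->
  attracted_to v lam x (billiard_orbit v lam y).
Proof.
move=> /andP[lam0 lam1] xy yN; rewrite /attracted_to -(cvg_shiftn N).
set x' := iter N T x in xy.
apply: (@squeeze_cvgr _ _ _ R (fun=> 0) (geometric (eucl_dist x' y) lam)).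
- near=> k; rewrite /= /dist_to_set iterD -/x'; apply/andP; split.
    apply: lb_le_inf; last by move=> _ [w _ <-]; exact: eucl_dist_ge0.
    by exists (eucl_dist (iter k T x') y), y => //; exists 0%N.
  have -> : eucl_dist x' y * lam ^+ k = eucl_dist (iter k T x') (iter k T y).
    rewrite eucl_dist_iter_same_code // => [|j]; first by rewrite mulrC.
    by rewrite xy.
  apply: ge_inf; first by exists 0 => _ [w _ <-]; exact: eucl_dist_ge0.
  by exists (iter k T y) => //; exists k.
- exact: cvg_cst.
- by apply: cvg_geometric; rewrite ger0_norm.
Unshelve. all: by end_near. Qed.

End SameCode.

Section Conclusion.
Variables (R : realType) (n : nat) (t : R) (v : 'I_n -> plane R).
Variables (c : plane R) (u : nat -> plane R).
Hypothesis fr : lattice_frame t v c u.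

Let ec : eventually_contracting t n.
Proof.
case: fr => nt _ _ _ _; case: nt => -[-> ->].
- exact: eventually_contracting_triangle.
- exact: eventually_contracting_square.
- exact: eventually_contracting_hexagon.
Qed.

Let n_gt0 : (0 < n)%N.
Proof. by case: fr => nt _ _ _ _; case: nt => -[->]. Qed.

Let sum_period (J : nat -> nat) m p r : (forall i, J (i + m)%N = J i) ->
  (\sum_(i < p * m + r) J i = p * \sum_(i < m) J i + \sum_(i < r) J i)%N.
Proof.
move=> per; elim: p => [|p IH] //.
rewrite !mulSn -!addnA big_split_ord /= -IH; congr addn.
by apply: eq_bigr => i _; rewrite addnC per.
Qed.

Lemma cycle_point_periodic lam J k m kappa z : 0 < lam -> (0 < m)%N ->
  (forall i, J (i + m)%N = J i) -> contracting t J m kappa ->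
  admissible t lam J (cycle_point t lam J m kappa z) ->
  periodic_point v lam (pt t c u k (cycle_point t lam J m kappa z)).
Proof.
move=> lam0 m0 per ct adm; split; first exact: (billiard_domain_pt fr adm).
(* After [m] steps the coordinates recur, but the vertex label has moved; after [n] such periods its
   total increment is a multiple of [n]. *)
exists (n * m)%N; first by rewrite muln_gt0 n_gt0.
have := sum_period n 0 per; rewrite addn0 big_ord0 addn0 => sumE.
rewrite (iter_billiard_pt fr _ _ adm) sumE -[X in traj _ _ _ _ X]add0n.
rewrite traj_cycle_point //= -(pt_modn fr) addnC [(n * _)%N]mulnC modnMDl.
exact: (pt_modn fr).
Qed.

Lemma code_pt_neq0 lam J k z q : admissible t lam J z ->
  billiard_code v lam (pt t c u k z) q != None.
Proof. by move=> adm; rewrite (billiard_code_pt fr _ _ adm). Qed.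

Lemma eventually_periodic_itinerary (lam : R) : 0 < lam <= 1 -> exists K : nat,
  forall x, billiard_domain v lam x ->
  exists N k J z m kappa, [/\ iter N (billiard v lam) x = pt t c u k z,
    admissible t lam J z, (0 < m)%N /\ (lam < 1 -> (m <= K)%N),
    forall i, J (i + m)%N = J i & contracting t J m kappa].
Proof.
move=> lam01; have [K KP] := ec lam01; exists K => x.
have lam0 : 0 < lam by case/andP: lam01.
move=> /(billiard_domain_coding fr lam0)[k [z [J [-> Jn adm]]]].
have [N [m [kappa [m0 mK per ct]]]] := KP J z Jn adm.
exists N, (k + \sum_(i < N) J i)%N, (fun i => J (N + i)%N), (traj t lam J z N), m, kappa.
split=> //; first exact: (iter_billiard_pt fr _ _ adm).
  exact: admissible_shift.
by move=> i; rewrite addnA per.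
Qed.

Lemma billiard_domain_iter_pt lam J k z q : admissible t lam J z ->
  billiard_domain v lam (iter q (billiard v lam) (pt t c u k z)).
Proof.
move=> adm; rewrite (iter_billiard_pt fr _ _ adm).
exact: (billiard_domain_pt fr (admissible_shift q adm)).
Qed.

Lemma code_iter lam x N q :
  billiard_code v lam (iter N (billiard v lam) x) q = billiard_code v lam x (q + N).
Proof. by rewrite /billiard_code iterD. Qed.

Lemma iter_fixed_mul (T : Type) (f : T -> T) x p j :
  iter p f x = x -> iter (j * p) f x = x.
Proof. by move=> px; elim: j => // j IH; rewrite mulSn iterD IH. Qed.

Lemma iter_fixed_iter (T : Type) (f : T -> T) x p j :
  iter p f x = x -> iter p f (iter j f x) = iter j f x.
Proof. by move=> px; rewrite -iterD addnC iterD px. Qed.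

Lemma billiard_orbit_iter lam x N : periodic_point v lam x ->
  billiard_orbit v lam (iter N (billiard v lam) x) = billiard_orbit v lam x.
Proof.
move=> [_ [p p0 px]]; apply/seteqP; split=> _ [k _ <-].
  by exists (k + N)%N => //; rewrite iterD.
(* Completing [N] steps to the multiple [N * p] of the period returns to [x]. *)
exists (k + (N * p - N))%N => //; rewrite -iterD -addnA subnK ?leq_pmulr //.
by rewrite iterD iter_fixed_mul.
Qed.

(** Each periodic orbit contains a point whose code has period [n * K!]: the factorial is a multiple
    of every increment period [m <= K], and the factor [n] makes the labels return. There are
    finitely many such codes, and each belongs to at most one periodic point, which [xget]
    selects. *)
Lemma finite_periodic_orbits lam : 0 < lam < 1 ->
  finite_set [set O | periodic_orbit v lam O].
Proof.
move=> /andP[lam0 lam1].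
have [|K KP] := @eventually_periodic_itinerary lam; first by rewrite lam0 ltW.
have M0 : (0 < n * K`!)%N by rewrite muln_gt0 n_gt0 fact_gt0.
pose P (f : {ffun 'I_(n * K`!) -> 'I_n}) : set (plane R) :=
  [set y | periodic_point v lam y /\
    forall q, billiard_code v lam y q = Some (f (Ordinal (ltn_pmod q M0)))].
apply: (@sub_finite_set _ _
  [set billiard_orbit v lam (xget (0 : plane R) (P f)) | f in setT]); last first.
  exact/finite_image/finite_finset.
move=> O [x xper ->].
have [N [k [J [z [m [kappa [xN adm [m0 mK] per _]]]]]]] := KP x xper.1.
exists [ffun i : 'I_(n * K`!) => vertex_label fr (k + \sum_(j < i) J j)] => //.
rewrite -(billiard_orbit_iter N xper) xN; congr billiard_orbit.
apply: xget_subset1; last first.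
  move=> y y' [yper yc] [y'per y'c]; apply: periodic_same_code_eq yper y'per.
  - by rewrite ltW.
  - by move=> q; rewrite yc y'c.
  - by move=> q; rewrite yc.
split.
  split; first exact: (billiard_domain_pt fr adm).
  have [_ [p p0 px]] := xper; exists p => //.
  by rewrite -xN iter_fixed_iter.
move=> q; rewrite (billiard_code_pt fr _ _ adm) ffunE /=; congr Some.
have /dvdnP[a aE] : (m %| K`!)%N by rewrite dvdn_fact // m0 mK.
apply: val_inj => /=; set r := (q %% _)%N.
have qE : q = ((q %/ (n * K`!) * a * n) * m + r)%N.
  rewrite {1}(divn_eq q (n * K`!)) -/r {2}aE; congr addn.
  by rewrite -!mulnA; congr muln; rewrite mulnCA.
have -> : (\sum_(i < q) J i = \sum_(i < (q %/ (n * K`!) * a * n) * m + r) J i)%N.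
  by rewrite -qE.
by rewrite sum_period // addnCA mulnAC modnMDl.
Qed.

Lemma attracted_to_periodic_orbit lam x : 0 < lam < 1 ->
  billiard_domain v lam x ->
  exists2 O, periodic_orbit v lam O & attracted_to v lam x O.
Proof.
move=> /andP[lam0 lam1].
have [|K KP] := @eventually_periodic_itinerary lam; first by rewrite lam0 ltW.
move=> /KP[N [k [J [z [m [kappa [xN adm [m0 _] per ct]]]]]]].
have adm' := cycle_point_admissible lam0 per ct adm.
pose y := pt t c u k (cycle_point t lam J m kappa z).
exists (billiard_orbit v lam y).
  by exists y => //; exact: (cycle_point_periodic k lam0 m0 per ct adm').
apply: (@attracted_same_code _ _ _ _ _ _ N); first by rewrite ltW.
  move=> q; rewrite xN (billiard_code_pt fr _ _ adm).
  by rewrite (billiard_code_pt fr _ _ adm').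
by move=> q; exact: code_pt_neq0 adm'.
Qed.

Lemma periodic_code_recovered x : periodic_point v 1 x ->
  exists2 e : R, 0 < e & forall lam : R, 1 - e < lam < 1 ->
    exists2 y, periodic_point v lam y &
      billiard_code v lam y =1 billiard_code v 1 x.
Proof.
move=> [xdom [p p0 px]].
have [|K KP] := @eventually_periodic_itinerary 1; first by rewrite ltr01 lexx.
have [N [k [J [z [m [kappa [xN adm [m0 _] per ct]]]]]]] := KP x xdom.
have near1 : \forall lam \near (1 : R),
    admissible t lam J (cycle_point t lam J m kappa z) /\ 0 < lam.
  apply: filterI; last exact: lt_nbhsr.
  exact: cycle_point_admissible_near.
have [e /= e0 eP] := (nbhs_ballP _ _).1 near1.
exists e => // lam /andP[le lt].
have [adm' lam0] : admissible t lam J (cycle_point t lam J m kappa z) /\ 0 < lam.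
  by apply: eP; rewrite /ball /= ger0_norm; lra.
set y := pt t c u k (cycle_point t lam J m kappa z).
(* The code of [y] is that of the [N]-th iterate of [x]; since [p] is a period of [x], another
   [p * N - N] steps realign it with the code of [x]. *)
exists (iter (p * N - N) (billiard v lam) y).
  have [_ [r r0 yr]] := cycle_point_periodic k lam0 m0 per ct adm'.
  split; first exact: billiard_domain_iter_pt adm'.
  by exists r => //; rewrite iter_fixed_iter.
move=> q; rewrite code_iter (billiard_code_pt fr _ _ adm').
rewrite -(billiard_code_pt fr _ _ adm) -xN code_iter -addnA subnK ?leq_pmull //.
by rewrite mulnC -code_iter iter_fixed_mul.
Qed.

End Conclusion.

Theorem claim1p1 (R : realType) (n : nat) (v : 'I_n -> plane R)
    (hn : n \in [:: 3%N; 4%N; 6%N]) (hv : regular_polygon v) :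
  (forall lam : R, 0 < lam < 1 ->
     finite_set [set O | periodic_orbit v lam O] /\
     (forall x, billiard_domain v lam x ->
        exists2 O, periodic_orbit v lam O & attracted_to v lam x O)) /\
  (forall x, periodic_point v 1 x ->
     exists2 e : R, 0 < e &
       forall lam : R, 1 - e < lam < 1 ->
         exists2 y, periodic_point v lam y & billiard_code v lam y =1 billiard_code v 1 x).
Proof.
have [t [c [u fr]]] := regular_lattice_frame hn hv.
split=> [lam lam01|x].
  split; first exact: (finite_periodic_orbits fr).
  by move=> x; exact: (attracted_to_periodic_orbit fr).
exact: (periodic_code_recovered fr).
Qed.
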